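(* Let $X$ be a real Banach space with rotund dual $X^*$, and let $K$ be a Chebyshev set in $X$. Then $K$ is convex if and only if it is an almost sun.
   Context: Rotund means strictly convex. For a nonempty closed set $K\subset X$, $d_K(x)=\inf\{\|x-k\|: k\in K\}$ and $P_K(x)=\{k\in K:\|x-k\|=d_K(x)\}$. A nonempty closed set $K$ is Chebyshev if $P_K(x)$ is a singleton for every $x\in X\setminus K$, and almost proximinal if $P_K(x)\ne\emptyset$ for a dense set of $x\in X\setminus K$. A point $x\in X\setminus K$ is a solar point of $K$ if there is $p(x)\in P_K(x)$ such that $p(x)\in P_K(x+t(x-p(x)))$ for all $t\ge0$. An almost proximinal set $K$ is an almost sun if the set of its solar points is dense in $X\setminus K$. *)

(* Defs.v *)
From HB Require Import structures.
From mathcomp Require Import all_boot all_order all_algebra.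
From mathcomp Require Import all_classical all_reals all_analysis.

Set Implicit Arguments.
Unset Strict Implicit.
Unset Printing Implicit Defensive.

Import Order.TTheory GRing.Theory Num.Theory.
Import numFieldNormedType.Exports.

Local Open Scope classical_set_scope.
Local Open Scope ring_scope.

Section RotundDual.
Context {R : realType}.

(* The space is a subset [D] of an ambient module [V], and [N] is only relied
   upon as a norm on [D]; this fits the dual below, which is a subspace of
   the module of all functions from X to R. *)
Definition rotund (V : lmodType R) (D : set V) (N : V -> R) : Prop :=
  forall u v, D u -> D v -> N u = 1 -> N v = 1 -> u <> v ->
    N (2^-1 *: (u + v)) < 1.

Variable X : normedModType R.

Definition dual_space : set (X -> R^o) := [set f | linear f /\ continuous f].

Definition dual_norm (f : X -> R^o) : R :=
  sup [set `|f x| | x in [set x : X | `|x| <= 1]].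

Definition rotund_dual : Prop := rotund dual_space dual_norm.

End RotundDual.

Section BestApproximation.
Context {R : realType} {X : normedModType R}.
Implicit Types (K : set X) (x : X).

Definition dist_to K x : R := inf [set `|x - k| | k in K].

Definition metric_proj K x : set X := [set k | K k /\ `|x - k| = dist_to K x].

Definition chebyshev_set K : Prop :=
  [/\ K !=set0, closed K &
      forall x, ~ K x -> exists p, metric_proj K x = [set p]].

Definition dense_in_compl K (S : set X) : Prop :=
  S `<=` ~` K /\ ~` K `<=` closure S.

Definition almost_proximinal K : Prop :=
  [/\ K !=set0, closed K &
      dense_in_compl K [set x | ~ K x /\ metric_proj K x !=set0]].

Definition solar_point K x : Prop :=
  ~ K x /\
  exists2 p, metric_proj K x p &
    forall t : R, 0 <= t -> metric_proj K (x + t *: (x - p)) p.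

Definition almost_sun K : Prop :=
  almost_proximinal K /\ dense_in_compl K [set x | solar_point K x].

End BestApproximation.

(* Main.v *)
(** Solar points are dense, so a point [x] outside [K] lies in the ball about
    some solar point [x0], with nearest point [p], of radius [`|x0 - p|].  Put
    [u := p - x0].  The function [g y := inf_(s >= 0) (`|y + s *: u| - s * `|u|)]
    is sublinear and dominated by the norm; it is nonnegative on [K - p] because
    [x0] is solar, and negative at [x - p].  By Hahn-Banach, for each [y] some
    linear functional below [g] touches [g] at [y].  Every such functional has
    norm one and attains its norm at [u], so rotundity of the dual leaves only
    one; hence [g] is linear and [x - p] is no convex combination of points of
    [K - p]. *)

Require Import Defs.
From mathcomp Require Import all_boot all_order all_algebra.
From mathcomp Require Import all_classical all_reals all_analysis.
From mathcomp Require Import ring lra.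

Set Implicit Arguments.
Unset Strict Implicit.
Unset Printing Implicit Defensive.

Import Order.TTheory GRing.Theory Num.Theory.
Import numFieldNormedType.Exports.

Local Open Scope classical_set_scope.
Local Open Scope ring_scope.

(** * Sublinear functionals and a Hahn-Banach theorem *)

Section Sublinear.
Context {R : realType} {V : lmodType R}.
Implicit Types (p q : V -> R) (x y w : V).

(** Homogeneity is asked only as an inequality, which passes easily to infima; scaling back by the
    inverse recovers equality. *)
Definition sublinear p :=
  (forall x y, p (x + y) <= p x + p y) /\
  (forall t x, 0 <= t -> p (t *: x) <= t * p x).

Lemma sublinear0 p : sublinear p -> p 0 = 0.
Proof.
move=> [pD pZ]; apply/eqP; rewrite eq_le; apply/andP; split.
  by have := pZ 0 0 (lexx _); rewrite scale0r mul0r.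
by have := pD 0 0; rewrite addr0 -[leLHS]addr0 lerD2l.
Qed.

Lemma sublinearZ p t x : sublinear p -> 0 <= t -> p (t *: x) = t * p x.
Proof.
move=> sp; rewrite le_eqVlt => /predU1P[<-|t0].
  by rewrite scale0r mul0r sublinear0.
have [_ pZ] := sp; apply/eqP; rewrite eq_le pZ ?(ltW t0)//=.
have ti0 : 0 <= t^-1 by rewrite invr_ge0 ltW.
have := pZ _ (t *: x) ti0.
by rewrite scalerA mulVf ?gt_eqF// scale1r ler_pdivlMl.
Qed.

Lemma sublinear_opp p x : sublinear p -> - p (- x) <= p x.
Proof.
move=> sp; have := sp.1 x (- x); rewrite subrr sublinear0// => h; lra.
Qed.

Lemma le_infD (A B : set R) c : A !=set0 -> B !=set0 ->
  (forall a b, A a -> B b -> c <= a + b) -> c <= inf A + inf B.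
Proof.
move=> A0 B0 cAB; rewrite -lerBlDr; apply: lb_le_inf => // a Aa.
rewrite lerBlDr addrC -lerBlDr; apply: lb_le_inf => // b Bb.
by rewrite lerBlDr addrC cAB.
Qed.

(** The index [k] may depend on the points, so the same criterion serves the infimum over a real
    parameter in [slide] and the infimum of a chain in Zorn's lemma. *)
Lemma sublinear_inf (I : Type) (D : set I) (F : I -> V -> R) :
  D !=set0 -> (forall x, has_lbound [set F i x | i in D]) ->
  (forall i j x y, D i -> D j ->
    exists2 k, D k & F k (x + y) <= F i x + F j y) ->
  (forall i t x, D i -> 0 <= t -> exists2 k, D k & F k (t *: x) <= t * F i x) ->
  sublinear (fun x => inf [set F i x | i in D]).
Proof.
move=> [i0 Di0] Flb FD FZ.
have ne x : [set F i x | i in D] !=set0 by exists (F i0 x), i0.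
have infP i x : D i -> inf [set F i x | i in D] <= F i x.
  by move=> Di; apply: ge_inf => //; exists i.
split=> [x y|t x t0].
  apply: le_infD => // _ _ [i Di <-] [j Dj <-].
  by have [k Dk] := FD _ _ x y Di Dj; apply: le_trans; exact: infP.
have le_tF i : D i -> inf [set F i (t *: x) | i in D] <= t * F i x.
  by move=> Di; have [k Dk] := FZ _ _ x Di t0; apply: le_trans; exact: infP.
move: t0; rewrite le_eqVlt => /predU1P[t0|t0].
  by have := le_tF _ Di0; rewrite -t0 !mul0r.
rewrite -ler_pdivrMl//; apply: lb_le_inf => // _ [i Di <-].
by rewrite ler_pdivrMl// le_tF.
Qed.

(** For sublinear [p] this is the one-sided directional derivative of [p] at [w] along [x]: for t >
    0 the term is the difference quotient of step 1/t. It is also the greatest sublinear functional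
    below [p] whose value at [- w] is at most [- p w]. *)
Definition slide p w x : R :=
  inf [set p (x + t *: w) - t * p w | t in [set t : R | 0 <= t]].

Section Slide.
Variables (p : V -> R) (w : V).
Hypothesis sp : sublinear p.

Let slide_lb x : has_lbound
  [set p (x + t *: w) - t * p w | t in [set t : R | 0 <= t]].
Proof.
(* Subadditivity gives p (t w) <= p (x + t w) + p (- x). *)
exists (- p (- x)) => _ [t /= t0 <-]; rewrite -sublinearZ// lerBrDr.
have := sp.1 (x + t *: w) (- x); rewrite addrAC subrr add0r => h; lra.
Qed.

Lemma slide_le t x : 0 <= t -> slide p w x <= p (x + t *: w) - t * p w.
Proof. by move=> t0; apply: ge_inf => //; exists t. Qed.

Lemma le_slide c x :
  (forall t, 0 <= t -> c <= p (x + t *: w) - t * p w) -> c <= slide p w x.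
Proof.
move=> cp; apply: lb_le_inf; first by exists (p (x + 0 *: w) - 0 * p w), 0 => /=.
by move=> _ [t /= t0 <-]; exact: cp.
Qed.

Lemma slide_le_id x : slide p w x <= p x.
Proof. by have := slide_le x (lexx 0); rewrite scale0r addr0 mul0r subr0. Qed.

Lemma slide_opp : slide p w (- w) <= - p w.
Proof.
by have := slide_le (- w) ler01; rewrite scale1r addNr sublinear0// mul1r add0r.
Qed.

Lemma sublinear_slide : sublinear (slide p w).
Proof.
apply: sublinear_inf => //; first by exists 0 => /=.
- move=> s t x y /= s0 t0; exists (s + t); first by rewrite /= addr_ge0.
  rewrite scalerDl [X in p X]addrACA mulrDl opprD [leRHS]addrACA lerD2r.
  exact: sp.1.
- move=> s t x /= s0 t0; exists (t * s); first by rewrite /= mulr_ge0.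
  by rewrite -scalerA -scalerDr sublinearZ// mulrBr mulrA.
Qed.

End Slide.

Lemma exists_minimal_sublinear p : sublinear p ->
  exists q, [/\ sublinear q, forall x, q x <= p x &
    forall r, sublinear r -> (forall x, r x <= q x) -> r = q].
Proof.
move=> sp; pose T := {q : V -> R | sublinear q /\ forall x, q x <= p x}.
(* The order is reversed, so that a maximal element for Zorn's lemma is a minimal functional. *)
pose below (q r : T) := `[< forall x, sval r x <= sval q x >].
have [| | | |[q [sq qp]] qmin] := @Zorn T below.
- by move=> q; apply/asboolP.
- move=> q r s /asboolP rq /asboolP sr; apply/asboolP => x.
  exact: le_trans (sr x) (rq x).
- move=> [q Pq] [r Pr] /asboolP/= rq /asboolP/= qr; apply: eq_exist.
  by apply/funext => x; apply/eqP; rewrite eq_le qr rq.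
- move=> A Atot; have [->|/set0P[q0 Aq0]] := eqVneq A set0.
    have Pp : sublinear p /\ forall x, p x <= p x by [].
    by exists (exist _ p Pp).
  (* A nonempty chain is bounded by its pointwise infimum, which is finite because - p (- x) <= - q
     (- x) <= q x. *)
  pose m x := inf [set sval q x | q in A].
  have Alb x : has_lbound [set sval q x | q in A].
    exists (- p (- x)) => _ [[q [sq qp]] _ <-] /=.
    by apply: le_trans (sublinear_opp x sq); rewrite lerN2.
  have mq (q : T) x : A q -> m x <= sval q x.
    by move=> Aq; apply: ge_inf => //; exists q.
  have sm : sublinear m.
    apply: sublinear_inf => //; first by exists q0.
    + move=> q r x y Aq Ar; have [/asboolP qr|/asboolP rq] := Atot _ _ Aq Ar.
        exists r => //; apply: le_trans ((svalP r).1.1 x y) _.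
        by rewrite lerD2r.
      exists q => //; apply: le_trans ((svalP q).1.1 x y) _.
      by rewrite lerD2l.
    + by move=> q t x Aq t0; exists q => //; exact: (svalP q).1.2.
  have mp x : m x <= p x by apply: le_trans (mq _ _ Aq0) _; exact: (svalP q0).2.
  exists (exist _ m (conj sm mp)) => q Aq; apply/asboolP => x; exact: mq.
exists q; split=> // r sr rq.
have rp x : r x <= p x by exact: le_trans (rq x) (qp x).
have /qmin : below (exist _ q (conj sq qp)) (exist _ r (conj sr rp)).
  exact/asboolP.
by move=> /(congr1 sval).
Qed.

(* A minimal sublinear [q] equals each of its own slides, which forces
   [q (x + w) = q x + q w]. *)
Lemma exists_linear_le p : sublinear p ->
  exists2 f : V -> R^o, linear f & forall x, f x <= p x.
Proof.
move=> /exists_minimal_sublinear[q [sq qp qmin]]; exists q => //.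
have qD x w : q (x + w) = q x + q w.
  apply/eqP; rewrite eq_le sq.1/=.
  have slideE : slide q w = q.
    by apply: qmin; [exact: sublinear_slide|exact: slide_le_id].
  have := slide_le w sq x ler01; rewrite slideE scale1r mul1r => h; lra.
have qN x : q (- x) = - q x.
  by have := qD x (- x); rewrite subrr sublinear0// => h; lra.
have qZ t x : q (t *: x) = t * q x.
  have [t0|t0] := leP 0 t; first exact: sublinearZ.
  apply: oppr_inj; rewrite -qN -scaleNr sublinearZ ?mulNr//.
  by rewrite oppr_ge0 ltW.
by move=> t x y; rewrite qD qZ.
Qed.

Lemma linear_funZ (f : V -> R^o) t x : linear f -> f (t *: x) = t * f x.
Proof.
move=> lf; have f0 : f 0 = 0.
  by have := lf 1 0 0; rewrite !scale1r addr0 => h; lra.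
by have := lf t x 0; rewrite !addr0 f0 addr0.
Qed.

Lemma linear_fun_opp (f : V -> R^o) x : linear f -> f (- x) = - f x.
Proof. by move=> lf; rewrite -scaleN1r linear_funZ// mulN1r. Qed.

(** A linear [f] below the slide of [p] along [w] has f (- w) <= - p w, that is, p w <= f w. *)
Lemma exists_linear_touching p w : sublinear p ->
  exists f : V -> R^o, [/\ linear f, forall x, f x <= p x & f w = p w].
Proof.
move=> sp; have [f lf fs] := exists_linear_le (sublinear_slide w sp).
have fp x : f x <= p x by exact: le_trans (fs x) (slide_le_id w sp x).
exists f; split=> //; apply/eqP; rewrite eq_le fp/=.
by rewrite -lerN2 -(linear_fun_opp _ lf); apply: le_trans (fs _) (slide_opp w sp).
Qed.

End Sublinear.

(** * Norm-one functionals and rotundity of the dual *)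

Section Dual.
Context {R : realType} {X : normedModType R}.
Implicit Types (f g : X -> R^o) (u x : X).

Lemma sublinear_norm : sublinear (fun x : X => `|x|).
Proof.
by split=> [x y|t x t0]; [exact: ler_normD|rewrite normrZ ger0_norm].
Qed.

Lemma linear_normr_le f x : linear f -> (forall y, f y <= `|y|) -> `|f x| <= `|x|.
Proof.
move=> lf fle.
by rewrite ler_norml fle andbT lerNl -(linear_fun_opp _ lf) -[leRHS]normrN fle.
Qed.

Lemma linear_dual_space f : linear f -> (forall y, f y <= `|y|) -> dual_space f.
Proof.
move=> lf fle; split=> // x; apply/cvgrPdist_le => e e0.
near=> y; have := lf (-1) y x; rewrite !scaleN1r [in RHS]addrC => <-.
apply: le_trans (linear_normr_le _ lf fle) _; rewrite addrC.
near: y; exact: cvgr_dist_le.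
Unshelve. all: by end_near. Qed.

(** Domination by the norm bounds the supremum by 1, and the unit vector along [u] attains it. *)
Lemma dual_norm1 f u : linear f -> (forall y, f y <= `|y|) -> u != 0 ->
  `|u| <= f u -> dual_norm f = 1.
Proof.
move=> lf fle u0 fu; apply/eqP; rewrite eq_le; apply/andP; split.
  apply: ge_sup; first by exists `|f 0|, 0 => //=; rewrite normr0.
  by move=> _ [x /= x1 <-]; apply: le_trans (linear_normr_le _ lf fle) x1.
have nu0 : 0 < `|u| by rewrite normr_gt0.
apply: (@le_trans _ _ `|f (`|u|^-1 *: u)|); last first.
  apply: ub_le_sup; last exists (`|u|^-1 *: u) => //=.
    exists 1 => _ [x /= x1 <-]; exact: le_trans (linear_normr_le _ lf fle) x1.
  by rewrite normrZ normfV normr_id mulVf ?gt_eqF.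
apply: le_trans (ler_norm _).
by rewrite linear_funZ// ler_pdivlMl// mulr1.
Qed.

(** The midpoint of [f] and [g] satisfies the same hypotheses, so it too has norm one, against
    rotundity if [f] and [g] differ. *)
Lemma rotund_dual_support_unique f g u : rotund_dual X -> u != 0 ->
  linear f -> (forall y, f y <= `|y|) -> `|u| <= f u ->
  linear g -> (forall y, g y <= `|y|) -> `|u| <= g u -> f = g.
Proof.
move=> rX u0 lf fle fu lg gle gu; apply: contrapT => fg.
have := rX _ _ (linear_dual_space lf fle) (linear_dual_space lg gle)
  (dual_norm1 lf fle u0 fu) (dual_norm1 lg gle u0 gu) fg.
rewrite (@dual_norm1 _ u) ?ltxx//.
- move=> t x y; change (2^-1 * (f (t *: x + y) + g (t *: x + y)) =
    t * (2^-1 * (f x + g x)) + 2^-1 * (f y + g y)).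
  rewrite lf lg; change (2^-1 * (t * f x + f y + (t * g x + g y)) =
    t * (2^-1 * (f x + g x)) + 2^-1 * (f y + g y)); ring.
- move=> y; change (2^-1 * (f y + g y) <= `|y|).
  have := fle y; have := gle y; lra.
- change (`|u| <= 2^-1 * (f u + g u)); lra.
Qed.

(** Sublinearity alone bounds the slide at a convex combination only from above. The lower bound
    comes from one linear functional below the slide that touches it at both [a] and [b]. *)
Lemma slide_norm_ge0_conv (u a b : X) (t : R) : rotund_dual X -> u != 0 ->
  0 <= t -> t <= 1 ->
  0 <= slide (fun x : X => `|x|) u a -> 0 <= slide (fun x : X => `|x|) u b ->
  0 <= slide (fun x : X => `|x|) u (t *: a + (1 - t) *: b).
Proof.
move=> rX u0 t0 t1; set g := slide _ u => ga gb.
have sg : sublinear g by exact/sublinear_slide/sublinear_norm.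
have support f : linear f -> (forall y, f y <= g y) ->
    (forall y, f y <= `|y|) /\ `|u| <= f u.
  move=> lf fg; split=> [y|].
    by apply: le_trans (fg y) _; exact: slide_le_id sublinear_norm _.
  rewrite -lerN2 -(linear_fun_opp _ lf); apply: le_trans (fg _) _.
  exact: slide_opp sublinear_norm.
have [f [lf fg fa]] := exists_linear_touching a sg.
have [f' [lf' f'g f'b]] := exists_linear_touching b sg.
have [fle fu] := support _ lf fg; have [f'le f'u] := support _ lf' f'g.
have ff' : f = f' by exact: (rotund_dual_support_unique rX u0).
apply: le_trans (fg _); rewrite lf.
rewrite (linear_funZ _ _ lf).
by rewrite fa [f b](congr1 (@^~ b) ff') f'b addr_ge0 ?mulr_ge0 ?subr_ge0.
Qed.

End Dual.

(** * Solar points and convexity *)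

Section BestApproximation.
Context {R : realType} {X : normedModType R}.
Implicit Types (K : set X) (x p k : X).

Lemma metric_proj_le K x p k : metric_proj K x p -> K k -> `|x - p| <= `|x - k|.
Proof.
move=> [_ ->] Kk; apply: ge_inf; last by exists k.
by exists 0 => _ [y _ <-].
Qed.

Lemma metric_projP K x p : K p -> (forall k, K k -> `|x - p| <= `|x - k|) ->
  metric_proj K x p.
Proof.
move=> Kp ple; split=> //; apply/eqP; rewrite eq_le; apply/andP; split.
  by apply: lb_le_inf; [exists `|x - p|, p|move=> _ [k Kk <-]; exact: ple].
by apply: ge_inf; [exists 0 => _ [y _ <-]|exists p].
Qed.

(** The homothety of centre [p] and ratio 1 / (1 + t) sends x + t (x - p) to [x] and, by convexity,
    each [k] in [K] to a point [k'] of [K]; this reduces the claim to minimality of [p] at [x]. *)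
Lemma convex_solar_point K x p : convex_set K -> ~ K x -> metric_proj K x p ->
  solar_point K x.
Proof.
move=> cK Kx xp; split=> //; exists p => // t t0.
apply: metric_projP => [|k Kk]; first by case: xp.
have t1 : 0 < 1 + t by rewrite ltr_wpDr.
have s0 : 0 <= (1 + t)^-1 by rewrite invr_ge0 ltW.
have s1 : (1 + t)^-1 <= 1 by rewrite invf_le1// lerDl.
pose k' : X := (1 + t)^-1 *: k + (1 - (1 + t)^-1) *: p.
have Kk' : K k'.
  have Kp : K p by case: xp.
  by have := cK k p (Itv01 s0 s1) (mem_set Kk) (mem_set Kp) => /set_mem.
have -> : x + t *: (x - p) - p = (1 + t) *: (x - p).
  by rewrite addrAC scalerDl scale1r.
have k'E : (1 + t) *: k' = k + t *: p.
  rewrite scalerDr !scalerA mulrBr mulr1 mulfV ?gt_eqF// scale1r.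
  by rewrite [1 + t]addrC addrK.
have -> : x + t *: (x - p) - k = (1 + t) *: (x - k').
  by rewrite !scalerBr k'E scalerDl scale1r opprD !addrA (addrAC _ (- (t *: p))).
by rewrite !normrZ ler_wpM2l// (metric_proj_le xp).
Qed.

Lemma chebyshev_proj K x : chebyshev_set K -> ~ K x ->
  exists p, metric_proj K x p.
Proof. by move=> [_ _ /(_ x) cK] /cK[p xp]; exists p; rewrite xp. Qed.

Lemma convex_almost_sun K : chebyshev_set K -> convex_set K -> almost_sun K.
Proof.
move=> cK vK; have [K0 Kc _] := cK; split; [split=> //|]; split.
- by move=> x [].
- move=> x Kx; apply: subset_closure; split=> //.
  by have [p] := chebyshev_proj cK Kx; exists p.
- by move=> x [].
- move=> x Kx; apply: subset_closure => /=.
  by have [p] := chebyshev_proj cK Kx; exact: convex_solar_point.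
Qed.

(** Solarity and the triangle inequality give (1 + t) |x - p| <= |x - p| + |k - p + t (p - x)|;
    cancelling |x - p| leaves each term of the infimum nonnegative. *)
Lemma solar_slide_ge0 K x p k :
  (forall t : R, 0 <= t -> metric_proj K (x + t *: (x - p)) p) -> K k ->
  0 <= slide (fun y : X => `|y|) (p - x) (k - p).
Proof.
move=> xp Kk; apply: le_slide => t t0; rewrite subr_ge0.
have := metric_proj_le (xp _ t0) Kk.
have -> : x + t *: (x - p) - p = (1 + t) *: (x - p).
  by rewrite addrAC scalerDl scale1r.
have -> : x + t *: (x - p) - k = (x - p) - (k - p + t *: (p - x)).
  by rewrite -[p - x]opprB scalerN opprD opprK opprB !addrA subrK addrAC.
rewrite normrZ ger0_norm ?addr_ge0// mulrDl mul1r.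
move=> /le_trans/(_ (ler_normB _ _)); rewrite lerD2l.
by rewrite [`|p - x|]distrC.
Qed.

Lemma almost_sun_convex K : rotund_dual X -> closed K -> almost_sun K ->
  convex_set K.
Proof.
move=> rX Kc [_ [_ Kd]] a b t /set_mem Ka /set_mem Kb; apply/mem_set.
pose x : X := t%:num *: (a : X) + (1 - t%:num) *: (b : X).
change (K x); apply: contrapT => Kx.
have /nbhs_ballP[e /= e0 xe] : nbhs x (~` K).
  by apply: open_nbhs_nbhs; split=> //; exact: closed_openC.
(* The radius e / 2 makes [x0] closer to [x] than to [p]: |x - p| >= e since [p] lies in [K], so |x
   - x0| < e / 2 < |p - x0|. *)
have [x0 [[Kx0 [p x0p solar]] xx0]] :=
  Kd _ Kx _ (nbhsx_ballx x (e / 2) ltac:(by rewrite divr_gt0)).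
have Kp : K p by case: x0p.
have {}xe : e <= `|x - p|.
  by rewrite leNgt; apply/negP => xpe; apply: (xe p) => //; rewrite -ball_normE.
have {}xx0 : `|x - x0| < e / 2 by move: xx0; rewrite -ball_normE.
have x0pe : e / 2 < `|p - x0|.
  have := ler_normD (x - x0) (x0 - p); rewrite addrA subrK [`|p - x0|]distrC.
  move=> h; lra.
have u0 : p - x0 != 0.
  by rewrite -normr_gt0; apply: lt_trans x0pe; rewrite divr_gt0.
have t0 : 0 <= t%:num by [].
have t1 : t%:num <= 1 by [].
have := slide_norm_ge0_conv rX u0 t0 t1
  (solar_slide_ge0 solar Ka) (solar_slide_ge0 solar Kb).
have -> : t%:num *: ((a : X) - p) + (1 - t%:num) *: ((b : X) - p) = x - p.
  by rewrite !scalerBr addrACA -opprD -scalerDl addrCA subrr addr0 scale1r.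
rewrite leNgt => /negP; apply.
(* The term of parameter 1 in the slide at x - p is |x - x0| - |p - x0|, which is negative. *)
apply: le_lt_trans (slide_le _ sublinear_norm _ ler01) _.
rewrite scale1r mul1r addrA subrK subr_lt0.
exact: lt_trans xx0 x0pe.
Qed.

End BestApproximation.

Theorem corollary3p4 (R : realType) (X : completeNormedModType R) (K : set X) :
  rotund_dual X -> chebyshev_set K -> (convex_set K <-> almost_sun K).
Proof.
move=> rX cK; split; first exact: convex_almost_sun.
by apply: almost_sun_convex => //; case: cK.
Qed.
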